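(* Let $n\ge 1$ be an integer. For every $p\in(1,\infty)$, every $f\colon\{-1,1\}^n\to\mathbb{R}$ with $\mathbb{E}f=0$, and every $t>0$, $$\|P_tf\|_p\le \exp\left(-\frac{(2p-2)t}{p^2-2p+2}\right)\cdot\|f\|_p .$$
   Context: $\{-1,1\}^n$ carries the uniform probability measure, $\mathbb{E}$ is expectation with respect to it, and $\|f\|_p=(\mathbb{E}|f|^p)^{1/p}$. For $S\subseteq\{1,\ldots,n\}$ and $x\in\{-1,1\}^n$ put $W_S(x)=\prod_{i\in S}x_i$ and $\widehat f(S)=\mathbb{E}[fW_S]$, so $f=\sum_S\widehat f(S)W_S$. For $t\ge0$, $P_tf=\sum_{S\subseteq\{1,\ldots,n\}}e^{-t|S|}\widehat f(S)W_S$. *)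

(* Defs.v *)
From mathcomp Require Import all_boot all_order all_algebra.
From mathcomp Require Import all_classical all_reals all_analysis.

Set Implicit Arguments.
Unset Strict Implicit.
Unset Printing Implicit Defensive.

Import Order.TTheory GRing.Theory Num.Theory.
Local Open Scope ring_scope.

(* The points of {-1,1}^n are encoded by booleans: the i-th coordinate of x
   is the sign (-1) ^+ x i, that is, 1 if x i = false and -1 if x i = true. *)
Notation cube n := {ffun 'I_n -> bool}.

Section Cube.
Variables (R : realType) (n : nat).
Implicit Types (f : cube n -> R) (x : cube n) (S : {set 'I_n}).

Definition cube_coord x (i : 'I_n) : R := (-1) ^+ x i.

Definition expect f : R := (\sum_(x : cube n) f x) / #|cube n|%:R.

Definition pnorm (p : R) f : R := expect (fun x => `|f x| `^ p) `^ p^-1.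

Definition walsh S x : R := \prod_(i in S) cube_coord x i.

Definition fourier f S : R := expect (fun x => f x * walsh S x).

Definition heat (t : R) f : cube n -> R :=
  fun x => \sum_(S : {set 'I_n}) expR (- (t * #|S|%:R)) * fourier f S * walsh S x.

End Cube.

(* Main.v *)
(** Let L be the generator, so that d/dt P_t f = - L P_t f, and put
    u = P_t f, v = |u|^(p-1) sgn u and g = |u|^(p/2) sgn u.  Then
    d/dt E|u|^p = - p E[v L u].  Writing the Dirichlet form as a sum over the
    edges of the cube, the Stroock-Varopoulos inequality and the Poincare
    inequality give E[v L u] >= 4(p-1)/p^2 Var g.  Writing Var g with an
    independent copy, a second two-point inequality gives
    Var g >= p^2/(2(p^2-2p+2)) Cov(u, v), and Cov(u, v) = E|u|^p because
    E u = 0.  Gronwall's lemma concludes.  Both two-point inequalities, at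
    values of size |a| = e^s and |b| = e^t, reduce to
    p |sinh((p-2)d)| <= |p-2| |sinh(p d)| with d = (s-t)/4. *)

Require Import Defs.
From mathcomp Require Import all_boot all_order all_algebra.
From mathcomp Require Import all_classical all_reals all_analysis.
From mathcomp Require Import ring lra.

Import Order.TTheory GRing.Theory Num.Theory.
Import numFieldNormedType.Exports.

Local Open Scope ring_scope.

(** * Two-point inequalities for signed powers *)

Section TwoPoint.
Local Open Scope classical_set_scope.
Variable R : realType.
Implicit Types (a b p r x y z : R).

(** With exponentials for [x] and [y], this is the monotonicity of cosh on the nonnegative
    half-line. *)
Lemma addrV_mono x y : 1 <= x -> x <= y -> x + x^-1 <= y + y^-1.
Proof.
move=> x1 xy; have x0 : 0 < x by lra.
have y0 : 0 < y by lra.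
have -> : y + y^-1 = x + x^-1 + (y - x) * (1 - (x * y)^-1).
  by field; rewrite !gt_eqF.
rewrite lerDl mulr_ge0 ?subr_ge0// invf_le1 ?mulr_gt0//; nra.
Qed.

(** The difference [h] of the two sides vanishes at 0, and its derivative is 2ab (cosh(ay) -
    cosh(by)) >= 0. *)
Lemma sinh_ratio_mono a b x : 0 <= b -> b <= a -> 0 <= x ->
  a * (expR (b * x) - expR (- (b * x))) <= b * (expR (a * x) - expR (- (a * x))).
Proof.
move=> b0 ba x0.
pose h y := b * (expR (a * y) - expR (- (a * y))) -
            a * (expR (b * y) - expR (- (b * y))).
pose h' y := a * b * (expR (a * y) + expR (- (a * y)) -
                      (expR (b * y) + expR (- (b * y)))).
have hD y : is_derive y 1 h (h' y).
  rewrite /h; apply: is_derive_eq; rewrite /h' /= /GRing.scale/=; ring.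
suff : h 0 <= h x by rewrite /h !mulr0 oppr0 subrr !mulr0 subrr subr_ge0.
apply: (@ger0_derive1_ndecr _ h 0 x) => //.
- move=> y; rewrite in_itv/= => /andP[y0 _].
  rewrite derive1E derive_val /h' !expRN mulr_ge0 ?mulr_ge0 ?subr_ge0//; first lra.
  apply: addrV_mono; last by rewrite ler_expR ler_wpM2r// ltW.
  by rewrite -(@expR0 R) ler_expR mulr_ge0// ltW.
- by apply: derivable_within_continuous.
Qed.

(** Squaring removes the signs of [b] and [x]; this covers b = p - 2 when p < 2. *)
Lemma sinh_sq_ratio_mono a b x : `|b| <= a ->
  a ^+ 2 * (expR (b * x) - expR (- (b * x))) ^+ 2 <=
  b ^+ 2 * (expR (a * x) - expR (- (a * x))) ^+ 2.
Proof.
move=> ba; have a0 : 0 <= a := le_trans (normr_ge0 b) ba.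
have sinhN y : (expR y - expR (- y)) ^+ 2 = (expR `|y| - expR (- `|y|)) ^+ 2.
  have [y0|y0] := leP 0 y; first by rewrite ger0_norm.
  by rewrite (ltr0_norm y0) opprK; ring.
have sinh_ge0 y : 0 <= y -> 0 <= expR y - expR (- y).
  by move=> y0; rewrite subr_ge0 ler_expR; lra.
rewrite [in leLHS]sinhN [in leRHS]sinhN !normrM (ger0_norm a0).
rewrite -[b ^+ 2]real_normK ?num_real// -!exprMn ler_sqr.
- exact: sinh_ratio_mono.
- by rewrite nnegrE mulr_ge0// sinh_ge0// mulr_ge0.
- by rewrite nnegrE mulr_ge0// sinh_ge0// mulr_ge0.
Qed.

Lemma powR_cross p a b : 1 < p -> 0 <= a -> 0 <= b ->
  let M := a `^ p + b `^ p in
  let X := a * b `^ (p - 1) + b * a `^ (p - 1) in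
  let Y := a `^ (p / 2) * b `^ (p / 2) in
  [/\ 0 <= Y, 2 * Y <= X, 2 * Y <= M &
      p ^+ 2 * (X - 2 * Y) <= (p - 2) ^+ 2 * (M - 2 * Y)].
Proof.
move=> p1; have p0 : p != 0 by lra.
have p10 : p - 1 != 0 by lra.
have p20 : p / 2 != 0 by lra.
(* If [a] or [b] is 0 there is no logarithm to take, but then X = Y = 0, since 0 to a nonzero power
   is 0. *)
rewrite [0 <= a]le_eqVlt [0 <= b]le_eqVlt.
case/predU1P => [<-|a0]; case/predU1P => [<-|b0]; rewrite /= ?powR0//.
- by rewrite !(mul0r, mulr0, addr0, subr0).
- by rewrite !(mul0r, mulr0, addr0, add0r, oppr0); split;
    rewrite ?powR_ge0// mulr_ge0 ?sqr_ge0 ?powR_ge0.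
- by rewrite !(mul0r, mulr0, addr0, add0r, oppr0); split;
    rewrite ?powR_ge0// mulr_ge0 ?sqr_ge0 ?powR_ge0.
(* Quarter logarithms keep fractions out of the exponents below: Y = m^2, while M - 2Y and X - 2Y
   become m^2 times the squares of 2 sinh(pd) and 2 sinh((p-2)d). *)
pose s := ln a / 4; pose t := ln b / 4.
have aE : a = expR (4 * s) by rewrite /s mulrC divfK ?lnK.
have bE : b = expR (4 * t) by rewrite /t mulrC divfK ?lnK.
pose d := s - t.
pose m := expR (p * (s + t)).
have m0 : 0 < m by apply: expR_gt0.
have -> : a `^ p = (m * expR (p * d)) ^+ 2.
  by rewrite aE -!expRM -expRD expr2 -expRD; congr expR; rewrite /d; ring.
have -> : b `^ p = (m * expR (- (p * d))) ^+ 2.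
  by rewrite bE -!expRM -expRD expr2 -expRD; congr expR; rewrite /d; ring.
have -> : a `^ (p / 2) = m * expR (p * d).
  by rewrite aE -!expRM -expRD; congr expR; rewrite /d; field.
have -> : b `^ (p / 2) = m * expR (- (p * d)).
  by rewrite bE -!expRM -expRD; congr expR; rewrite /d; field.
have -> : a * b `^ (p - 1) = (m * expR (- ((p - 2) * d))) ^+ 2.
  by rewrite aE bE -!expRM expr2 -!expRD; congr expR; rewrite /d; ring.
have -> : b * a `^ (p - 1) = (m * expR ((p - 2) * d)) ^+ 2.
  by rewrite aE bE -!expRM expr2 -!expRD; congr expR; rewrite /d; ring.
have VE y : expR y * expR (- y) = 1 by rewrite -expRD subrr expR0.
have p2 : `|p - 2| <= p by rewrite ler_norml; lra.
have := sinh_sq_ratio_mono p (p - 2) d p2.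
move: (VE (p * d)) (VE ((p - 2) * d)) (expR_gt0 (p * d)) (expR_gt0 (- (p * d))).
move: (expR (p * d)) (expR (- (p * d))) => u u'.
move: (expR ((p - 2) * d)) (expR (- ((p - 2) * d))) => w w' uE wE u0 u'0 H.
have -> : m * u * (m * u') = m ^+ 2 by rewrite -[RHS]mulr1 -uE; ring.
have XE : (m * w') ^+ 2 + (m * w) ^+ 2 - 2 * m ^+ 2 = m ^+ 2 * (w - w') ^+ 2.
  have mE : m ^+ 2 = m ^+ 2 * (w * w') by rewrite wE mulr1.
  by rewrite [X in _ - 2 * X]mE; ring.
have ME : (m * u) ^+ 2 + (m * u') ^+ 2 - 2 * m ^+ 2 = m ^+ 2 * (u - u') ^+ 2.
  have mE : m ^+ 2 = m ^+ 2 * (u * u') by rewrite uE mulr1.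
  by rewrite [X in _ - 2 * X]mE; ring.
split; first exact: sqr_ge0.
- by rewrite -subr_ge0 XE mulr_ge0 ?sqr_ge0.
- by rewrite -subr_ge0 ME mulr_ge0 ?sqr_ge0.
by rewrite XE ME ![_ * (m ^+ 2 * _)]mulrCA ler_wpM2l ?sqr_ge0.
Qed.

(** The odd extension of the power function; r = p - 1 gives v and r = p/2 gives g. *)
Definition signed_powR (r a : R) : R := Num.sg a * `|a| `^ r.

Lemma mulr_signed_powR p a : 0 < p -> a * signed_powR (p - 1) a = `|a| `^ p.
Proof. by move=> p0; rewrite mulrA -[a * _]mulrC -normrEsg mulr_powRB1. Qed.

Lemma sqr_signed_powR p a : p != 0 -> signed_powR (p / 2) a ^+ 2 = `|a| `^ p.
Proof.
move=> p0; rewrite exprMn sqr_sg; have [->|a0] := eqVneq a 0.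
  by rewrite normr0 mul0r powR0.
by rewrite mul1r expr2 -powRD ?normr_eq0 ?a0 ?implybT// -splitr.
Qed.

(* [e] is the product of the signs of [a] and [b]. *)
Lemma two_point_expand p a b : 1 < p -> exists e M X Y : R,
  [/\ (a - b) * (signed_powR (p - 1) a - signed_powR (p - 1) b) = M - e * X,
      (signed_powR (p / 2) a - signed_powR (p / 2) b) ^+ 2 = M - e * (2 * Y),
      [\/ e = 0, e = 1 | e = -1],
      0 <= Y & [/\ 2 * Y <= X, 2 * Y <= M &
      p ^+ 2 * (X - 2 * Y) <= (p - 2) ^+ 2 * (M - 2 * Y)]].
Proof.
move=> p1; have p0 : 0 < p by lra.
have [Y0 XY MY key] := powR_cross _ _ _ p1 (normr_ge0 a) (normr_ge0 b).
exists (Num.sg a * Num.sg b), (`|a| `^ p + `|b| `^ p),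
  (`|a| * `|b| `^ (p - 1) + `|b| * `|a| `^ (p - 1)),
  (`|a| `^ (p / 2) * `|b| `^ (p / 2)); split=> //.
- rewrite -(mulr_signed_powR _ a p0) -(mulr_signed_powR _ b p0).
  rewrite [X in _ = _ - X](_ : _ = (Num.sg a * `|a|) * signed_powR (p - 1) b +
      (Num.sg b * `|b|) * signed_powR (p - 1) a); last by rewrite /signed_powR; ring.
  by rewrite !mulr_sg_norm; ring.
- by rewrite -(sqr_signed_powR p a) -?(sqr_signed_powR p b) ?gt_eqF// /signed_powR; ring.
- by case: sgrP => _; case: sgrP => _; rewrite ?(mul0r, mulr0, mul1r, mulr1, mulrNN);
    constructor.
Qed.

(** For equal signs (e = 1) the claim is exactly the last bound of [powR_cross], because p^2 -
    4(p-1) = (p-2)^2. For opposite signs X >= 2Y suffices. *)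
Lemma stroock_varopoulos p a b : 1 < p ->
  4 * (p - 1) * (signed_powR (p / 2) a - signed_powR (p / 2) b) ^+ 2 <=
  p ^+ 2 * ((a - b) * (signed_powR (p - 1) a - signed_powR (p - 1) b)).
Proof.
move=> p1.
have [e [M [X [Y [-> -> es Y0 [XY MY key]]]]]] := two_point_expand _ a b p1.
have := mulr_ge0 (sqr_ge0 (p - 2)) Y0.
have : 0 <= (p - 2) ^+ 2 * M by rewrite mulr_ge0 ?sqr_ge0//; lra.
have : 0 <= (p - 1) * Y by rewrite mulr_ge0//; lra.
have : 0 <= p ^+ 2 * (X - 2 * Y) by rewrite mulr_ge0 ?sqr_ge0//; lra.
case: es => ->; nra.
Qed.

(** The constant is p^2 + (p-2)^2. For equal signs X >= 2Y suffices; for opposite signs one needs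
    p^2 (X - 2Y) <= (p-2)^2 (M + 2Y), which follows from [powR_cross] and Y >= 0. *)
Lemma signed_powR_variance p a b : 1 < p ->
  p ^+ 2 * ((a - b) * (signed_powR (p - 1) a - signed_powR (p - 1) b)) <=
  2 * (p ^+ 2 - 2 * p + 2) * (signed_powR (p / 2) a - signed_powR (p / 2) b) ^+ 2.
Proof.
move=> p1.
have [e [M [X [Y [-> -> es Y0 [XY MY key]]]]]] := two_point_expand _ a b p1.
have := mulr_ge0 (sqr_ge0 (p - 2)) Y0.
have : 0 <= (p - 2) ^+ 2 * M by rewrite mulr_ge0 ?sqr_ge0//; lra.
have : 0 <= p ^+ 2 * Y by rewrite mulr_ge0 ?sqr_ge0.
have : 0 <= p ^+ 2 * (X - 2 * Y) by rewrite mulr_ge0 ?sqr_ge0//; lra.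
case: es => ->; nra.
Qed.

(** * Differentiability of the power of the absolute value *)

Lemma is_derive_norm_powR p a : 1 < p ->
  is_derive a 1 (fun y => `|y| `^ p) (p * signed_powR (p - 1) a).
Proof.
move=> p1; have [a0|a0|->] := ltrgt0P a.
- have -> : p * signed_powR (p - 1) a = p * a `^ (p - 1).
    by rewrite /signed_powR gtr0_sg// mul1r gtr0_norm.
  apply: (@near_eq_is_derive _ _ _ (@powR R ^~ p)).
    near=> y; rewrite gtr0_norm//; near: y; exact: lt_nbhsr.
  exact: is_derive1_powR.
- have -> : p * signed_powR (p - 1) a = (p * (- a) `^ (p - 1)) * -1.
    by rewrite /signed_powR ltr0_sg// ltr0_norm//; ring.
  apply: (@near_eq_is_derive _ _ _ ((@powR R ^~ p) \o -%R)).
    near=> y; rewrite /= ltr0_norm//; near: y; exact: lt_nbhsl.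
  by apply: is_derive1_comp; apply: is_derive1_powR; rewrite oppr_gt0.
(* At 0 the difference quotient has absolute value |h|^(p-1), which tends to 0 as p > 1. *)
rewrite /signed_powR sgr0 mul0r mulr0.
suff H : (fun h : R => h^-1 *:
    (((fun y => `|y| `^ p) \o shift 0) (h *: 1) - `|0 : R| `^ p)) @ 0^' --> (0 : R).
  by split; [apply/cvg_ex; exists 0 | exact: cvg_lim].
apply/cvgrPdist_le => e e0; near=> h.
have h0 : h != 0 by near: h; exact: nbhs_dnbhs_neq.
rewrite /= normr0 powR0 ?gt_eqF//; last lra.
rewrite sub0r subr0 normrN addr0 [h *: 1]mulr1 normrZ normfV.
rewrite (ger0_norm (powR_ge0 _ _)) -(@mulr_powRB1 _ _ p)//; last lra.
rewrite mulKf ?normr_eq0//.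
have -> : e = (e `^ (p - 1)^-1) `^ (p - 1).
  by rewrite -powRrM mulVf ?powRr1 ?ltW//; lra.
apply: ge0_ler_powR; rewrite ?nnegrE ?powR_ge0//; first lra.
near: h; apply: dnbhs0_le; exact: powR_gt0.
Unshelve. all: end_near. Qed.
End TwoPoint.

Arguments signed_powR {R} r a.

(** * Walsh expansion on the cube *)

Section CubeCalculus.
Variables (R : realType) (n : nat).
Implicit Types (f g : cube n -> R) (x y : cube n) (S : {set 'I_n}) (i : 'I_n).

Let N : R := #|cube n|%:R.

Lemma card_cube_gt0 : 0 < N.
Proof. by rewrite /N card_ffun card_bool card_ord ltr0n expn_gt0. Qed.

(** The sum factors as the product over i of 1 + x_i y_i, whose factors are 2 where the points agree
    and 0 where they differ. *)
Lemma walsh_mul_sum x y : \sum_S walsh R S x * walsh R S y = N * (x == y)%:R.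
Proof.
under eq_bigr => S _ do rewrite -big_split /= big_mkcond /=.
rewrite -(@bigA_distr _ 0 1 *%R +%R _
  (fun i => cube_coord R x i * cube_coord R y i) (fun=> 1)).
have [<-|xy] := eqVneq x y.
  rewrite mulr1 /N card_ffun card_bool card_ord natrX -[in RHS](card_ord n) -prodr_const.
  by apply: eq_bigr => i _; rewrite /cube_coord -signr_addb addbb.
rewrite mulr0; have [i xyi] : exists i, x i != y i.
  by apply/existsP; apply: contra_neqT xy => /existsPn E;
    apply/ffunP => i; apply/eqP; rewrite -[_ == _]negbK E.
rewrite (bigD1 i)//= /cube_coord -signr_addb; case: (x i) (y i) xyi => -[]//= _.
  by rewrite expr1 addNr mul0r.
by rewrite expr1 addNr mul0r.
Qed.

Lemma fourier_inversion f x : \sum_S fourier f S * walsh R S x = f x.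
Proof.
have N0 : N != 0 by rewrite gt_eqF ?card_cube_gt0.
rewrite /fourier /expect -/N.
under eq_bigr => S _ do rewrite -mulrA mulrC mulr_sumr.
rewrite exchange_big (bigD1 x)//= [X in _ + X]big1 ?addr0.
  transitivity (f x / N * \sum_S walsh R S x * walsh R S x).
    by rewrite mulr_sumr; apply: eq_bigr => S _; ring.
  by rewrite walsh_mul_sum eqxx mulr1 divfK.
move=> y /negPf xy; transitivity (f y / N * \sum_S walsh R S y * walsh R S x).
  by rewrite mulr_sumr; apply: eq_bigr => S _; ring.
by rewrite walsh_mul_sum xy !mulr0.
Qed.

(** Weight 1 gives Parseval's identity; weight |S| gives the Dirichlet form. *)
Lemma parseval_weighted (w : {set 'I_n} -> R) f :
  \sum_x f x * (\sum_S w S * fourier f S * walsh R S x) =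
  N * \sum_S w S * fourier f S ^+ 2.
Proof.
have N0 : N != 0 by rewrite gt_eqF ?card_cube_gt0.
under eq_bigr => x _ do rewrite mulr_sumr.
rewrite exchange_big mulr_sumr; apply: eq_bigr => S _ /=.
rewrite [in RHS]expr2 {3}/fourier /expect -/N.
transitivity (w S * fourier f S * \sum_x f x * walsh R S x).
  by rewrite mulr_sumr; apply: eq_bigr => x _; ring.
by field.
Qed.

(** * Coordinate flips, the generator and the Poincare inequality *)

Definition flip i x : cube n := [ffun j => x j (+) (j == i)].

Lemma flipK i : involutive (flip i).
Proof. by move=> x; apply/ffunP => j; rewrite !ffunE -addbA addbb addbF. Qed.

Lemma sum_flip i (F : cube n -> R) : \sum_x F (flip i x) = \sum_x F x.
Proof. by rewrite [RHS](reindex_inj (inv_inj (flipK i))). Qed.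

Lemma walsh_flip S i x : walsh R S (flip i x) = (-1) ^+ (i \in S) * walsh R S x.
Proof.
rewrite /walsh /cube_coord; under eq_bigr => j _ do rewrite ffunE signr_addb.
rewrite big_split /= mulrC; congr (_ * _).
have [iS|iS] := boolP (i \in S); last first.
  by rewrite big1// => j jS; case: eqP => // ji; rewrite -ji jS in iS.
by rewrite (bigD1 i)//= eqxx big1 ?mulr1// => j /andP[_ /negPf ->].
Qed.

(** Flipping a coordinate of [S] negates the Walsh function, so the sum equals its own opposite. *)
Lemma sum_walsh S : S != finset.set0 -> \sum_x walsh R S x = 0.
Proof.
case/finset.set0Pn => i iS; have := sum_flip i (walsh R S).
under eq_bigr => x _ do rewrite walsh_flip iS expr1 mulN1r.
rewrite sumrN; lra.
Qed.

(* The generator: [P_t = exp (- t * gen)]. *)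
Definition gen f x : R := 2^-1 * \sum_i (f x - f (flip i x)).

Lemma gen_walsh S x : gen (walsh R S) x = #|S|%:R * walsh R S x.
Proof.
rewrite /gen; under eq_bigr => i _ do rewrite walsh_flip.
transitivity (2^-1 * \sum_(i in S) (2 * walsh R S x)).
  congr (_ * _); rewrite [RHS]big_mkcond /=; apply: eq_bigr => i _.
  by case: (i \in S); rewrite /= ?expr0 ?expr1; ring.
by rewrite sumr_const -mulr_natl; field.
Qed.

Lemma gen_sum_walsh (a : {set 'I_n} -> R) x :
  gen (fun y => \sum_S a S * walsh R S y) x =
  \sum_(S : {set 'I_n}) #|S|%:R * a S * walsh R S x.
Proof.
under [RHS]eq_bigr => S _ do rewrite mulrAC -gen_walsh /gen -mulrA mulr_suml.
rewrite -mulr_sumr exchange_big /=; congr (_ * _); apply: eq_bigr => i _.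
by rewrite -sumrB; apply: eq_bigr => S _; ring.
Qed.

Lemma gen_fourier f x :
  gen f x = \sum_(S : {set 'I_n}) #|S|%:R * fourier f S * walsh R S x.
Proof.
rewrite -gen_sum_walsh; congr (gen _ _); apply/funext => y.
by rewrite fourier_inversion.
Qed.

(** In each direction the sum is averaged with its image under the flip; this average and the factor
    1/2 of [gen] make up the 1/4. *)
Lemma dirichlet_form f g :
  \sum_x g x * gen f x =
  4^-1 * \sum_i \sum_x (f x - f (flip i x)) * (g x - g (flip i x)).
Proof.
transitivity (2^-1 * \sum_i \sum_x g x * (f x - f (flip i x))).
  rewrite exchange_big mulr_sumr; apply: eq_bigr => x _ /=.
  by rewrite -mulr_sumr mulrCA.
rewrite !mulr_sumr; apply: eq_bigr => i _.
have E : \sum_x g (flip i x) * (f (flip i x) - f x) =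
    \sum_x g x * (f x - f (flip i x)).
  by rewrite -[RHS](sum_flip i); apply: eq_bigr => x _; rewrite flipK.
transitivity (4^-1 * (\sum_x g x * (f x - f (flip i x)) +
                      \sum_x g (flip i x) * (f (flip i x) - f x))).
  by rewrite E; field.
by congr (_ * _); rewrite -big_split; apply: eq_bigr => x _ /=; ring.
Qed.

(** In Fourier coefficients the left side has weight 0 at the empty set and 1 elsewhere, the right
    side has weight |S|. Sums are not normalized, so the left side is N Var g. *)
Lemma poincare g :
  \sum_x g x ^+ 2 - (\sum_x g x) ^+ 2 / N <= \sum_x g x * gen g x.
Proof.
have N0 := card_cube_gt0.
have -> : \sum_x g x ^+ 2 = N * \sum_S 1 * fourier g S ^+ 2.
  rewrite -parseval_weighted; apply: eq_bigr => x _.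
  by rewrite expr2 -[in X in _ * X]fourier_inversion; congr (_ * _);
    apply: eq_bigr => S _; rewrite mul1r.
have -> : (\sum_x g x) ^+ 2 / N = N * \sum_S (S == finset.set0)%:R * fourier g S ^+ 2.
  rewrite (bigD1 finset.set0)//= eqxx [X in _ + X]big1 ?addr0 => [|S /negPf ->];
    last by rewrite mul0r.
  rewrite /fourier /expect -/N /walsh;
    under [in RHS]eq_bigr => x _ do rewrite big_set0 mulr1.
  by rewrite mul1r; field; rewrite gt_eqF.
under [leRHS]eq_bigr => x _ do rewrite gen_fourier.
rewrite parseval_weighted -mulrBr ler_wpM2l ?(ltW N0)// -sumrB; apply: ler_sum => S _.
rewrite -mulrBl ler_wpM2r ?sqr_ge0//; have [->|S0] := eqVneq S finset.set0.
  by rewrite cards0 subrr.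
by rewrite subr0 ler1n card_gt0.
Qed.

(** The independent-copy form of 2 N^2 Cov(f, g), to which pointwise two-point inequalities
    apply. *)
Lemma two_copies_cov f g :
  \sum_x \sum_y (f x - f y) * (g x - g y) =
  2 * (N * (\sum_x f x * g x) - (\sum_x f x) * (\sum_x g x)).
Proof.
have H x : \sum_y (f x - f y) * (g x - g y) =
    N * (f x * g x) + \sum_y f y * g y - f x * (\sum_y g y) - g x * (\sum_y f y).
  rewrite !mulr_sumr.
  have -> : N * (f x * g x) = \sum_(y : cube n) f x * g x.
    by rewrite sumr_const mulr_natl.
  by rewrite -big_split -!sumrB; apply: eq_bigr => y _ /=; ring.
under eq_bigr => x _ do rewrite H.
rewrite !sumrB big_split /= sumr_const -!mulr_sumr -!mulr_suml -mulr_natl -/N; ring.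
Qed.

(** * The heat semigroup and its evolution equation *)

Lemma heat0 f : heat 0 f = f.
Proof.
apply/funext => x; rewrite /heat -[RHS]fourier_inversion; apply: eq_bigr => S _.
by rewrite mul0r oppr0 expR0 mul1r.
Qed.

(** Only the empty set contributes to the sum, and its coefficient is the mean of [f]. *)
Lemma sum_heat f t : expect f = 0 -> \sum_x heat t f x = 0.
Proof.
move=> f0; rewrite /heat exchange_big big1//= => S _; rewrite -mulr_sumr.
have [->|S0] := eqVneq S finset.set0; last by rewrite sum_walsh ?mulr0.
rewrite /fourier (_ : (fun x => _) = f) ?f0 ?mulr0 ?mul0r//.
by apply/funext => x; rewrite /walsh big_set0 mulr1.
Qed.

Lemma is_derive_sumT (I : finType) (h : I -> R -> R) (dh : I -> R) (t : R) :
  (forall j, is_derive t 1 (h j) (dh j)) ->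
  is_derive t 1 (fun s => \sum_j h j s) (\sum_j dh j).
Proof.
move=> hD; have -> : (fun s => \sum_j h j s) = \sum_j h j.
  by apply/funext => s; rewrite fct_sumE.
elim/big_ind2 : _ => // [|*]; [exact: is_derive_cst|exact: is_deriveD].
Qed.

Lemma is_derive_heat f x (t : R) :
  is_derive t 1 (fun s => heat s f x) (- gen (heat t f) x).
Proof.
rewrite /heat gen_sum_walsh -sumrN; apply: is_derive_sumT => S.
apply: is_derive_eq; rewrite /GRing.scale /=; ring.
Qed.

(** * Energy estimate and exponential decay *)

Lemma energy_ge (p : R) f : 1 < p -> \sum_x f x = 0 ->
  (2 * p - 2) / (p ^+ 2 - 2 * p + 2) * \sum_x `|f x| `^ p <=
  \sum_x signed_powR (p - 1) (f x) * gen f x.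
Proof.
move=> p1 f0; have N0 := card_cube_gt0; have p0 : 0 < p by lra.
set g := fun x => signed_powR (p / 2) (f x); set v := fun x => signed_powR (p - 1) (f x).
pose V := \sum_x g x ^+ 2 - (\sum_x g x) ^+ 2 / N.
have normE : \sum_x `|f x| `^ p = \sum_x f x * v x.
  by apply: eq_bigr => x _; rewrite mulr_signed_powR.
(* Poincare for g, then Stroock-Varopoulos on every edge of the cube. *)
have lower : 4 * (p - 1) * V <= p ^+ 2 * \sum_x v x * gen f x.
  apply: (@le_trans _ _ (4 * (p - 1) * \sum_x g x * gen g x)).
    by rewrite ler_wpM2l ?poincare//; lra.
  rewrite !dirichlet_form ![_ * (4^-1 * _)]mulrCA ler_wpM2l// !mulr_sumr.
  apply: ler_sum => i _; rewrite !mulr_sumr; apply: ler_sum => x _.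
  by rewrite -expr2 stroock_varopoulos.
(* Here the two-point inequality is summed over all pairs of points; since [f] has sum 0, the
   product of sums in the covariance vanishes. *)
have upper : p ^+ 2 * \sum_x f x * v x <= 2 * (p ^+ 2 - 2 * p + 2) * V.
  rewrite -(ler_pM2l (mulr_gt0 (ltr0n R 2) N0)).
  have -> : 2 * N * (p ^+ 2 * \sum_x f x * v x) =
      \sum_x \sum_y p ^+ 2 * ((f x - f y) * (v x - v y)).
    under [RHS]eq_bigr => x _ do rewrite -mulr_sumr.
    by rewrite -mulr_sumr two_copies_cov f0; ring.
  have -> : 2 * N * (2 * (p ^+ 2 - 2 * p + 2) * V) =
      \sum_x \sum_y 2 * (p ^+ 2 - 2 * p + 2) * ((g x - g y) ^+ 2).
    under [RHS]eq_bigr => x _ do rewrite -mulr_sumr.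
    rewrite -mulr_sumr two_copies_cov /V.
    under [\sum_x g x * g x]eq_bigr => x _ do rewrite -expr2.
    by field; rewrite gt_eqF.
  by apply: ler_sum => x _; apply: ler_sum => y _; apply: signed_powR_variance.
have D0 : 0 < p ^+ 2 - 2 * p + 2 by nra.
rewrite -(ler_pM2l (exprn_gt0 2 p0)) (le_trans _ lower)// normE.
have -> : p ^+ 2 * ((2 * p - 2) / (p ^+ 2 - 2 * p + 2) * \sum_x f x * v x) =
    (2 * p - 2) / (p ^+ 2 - 2 * p + 2) * (p ^+ 2 * \sum_x f x * v x) by ring.
have -> : 4 * (p - 1) * V =
    (2 * p - 2) / (p ^+ 2 - 2 * p + 2) * (2 * (p ^+ 2 - 2 * p + 2) * V).
  by field; rewrite gt_eqF.
by rewrite ler_wpM2l// divr_ge0 ?ltW//; lra.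
Qed.

(** Gronwall by an integrating factor: by [energy_ge], applied to [heat s f], the function [F] has
    nonpositive derivative, and F(t) <= F(0) is the claim. *)
Lemma heat_norm_decay (p : R) f (t : R) : 1 < p -> expect f = 0 -> 0 <= t ->
  \sum_x `|heat t f x| `^ p <=
  expR (- (p * ((2 * p - 2) / (p ^+ 2 - 2 * p + 2)) * t)) * \sum_x `|f x| `^ p.
Proof.
move=> p1 f0 t0; set c := _ / _.
pose F s := expR (p * c * s) * \sum_x `|heat s f x| `^ p.
pose F' s := p * expR (p * c * s) *
  (c * (\sum_x `|heat s f x| `^ p) -
   \sum_x signed_powR (p - 1) (heat s f x) * gen (heat s f) x).
have FD (s : R) : is_derive s 1 F (F' s).
  have sumD : is_derive s 1 (fun r => \sum_x `|heat r f x| `^ p)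
      (\sum_x p * signed_powR (p - 1) (heat s f x) * - gen (heat s f) x).
    apply: is_derive_sumT => x; have hD := is_derive_heat f x s.
    exact: (is_derive1_comp (is_derive_norm_powR _ _ _ p1) hD).
  rewrite /F; apply: is_derive_eq; rewrite /F' /GRing.scale /=.
  under eq_bigr => x _ do rewrite mulrN -mulrA.
  by rewrite sumrN -mulr_sumr; ring.
suff : F t <= F 0.
  by rewrite /F mulr0 expR0 mul1r heat0 expRN mulrC -ler_pdivlMr ?expR_gt0// mulrC.
apply: (@ler0_derive1_nincr _ F 0 t) => //.
- move=> s; rewrite in_itv/= => /andP[s0 _].
  rewrite derive1E derive_val /F' mulr_ge0_le0 ?mulr_ge0 ?expR_ge0//; first lra.
  by rewrite subr_le0 energy_ge// sum_heat.
- by apply: derivable_within_continuous.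
Qed.
End CubeCalculus.

(** * From p-th powers to norms *)

Theorem theorem1p2 (R : realType) (n : nat) (hn : (1 <= n)%N) (p : R) (hp : 1 < p)
    (f : cube n -> R) (hf : expect f = 0) (t : R) (ht : 0 < t) :
  pnorm p (heat t f) <=
    expR (- ((2 * p - 2) * t / (p ^+ 2 - 2 * p + 2))) * pnorm p f.
Proof.
have p0 : 0 < p by lra.
have sum_ge0 (g : cube n -> R) : 0 <= \sum_x `|g x| `^ p.
  by apply: sumr_ge0 => x _; apply: powR_ge0.
set D := p ^+ 2 - 2 * p + 2.
(* Written as a p-th root, the decay factor merges with the norm, and monotonicity of the root
   leaves the bound on p-th powers. *)
have -> : expR (- ((2 * p - 2) * t / D)) =
    expR (- (p * ((2 * p - 2) / D) * t)) `^ p^-1.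
  rewrite -expRM; congr expR.
  have D0 : 0 < D by rewrite /D; nra.
  by field; rewrite !gt_eqF.
rewrite /pnorm /expect -powRM ?expR_ge0//; last by rewrite divr_ge0.
apply: ge0_ler_powR; rewrite ?nnegrE ?divr_ge0 ?mulr_ge0 ?expR_ge0 ?invr_ge0 ?divr_ge0
  ?(ltW p0)//.
by rewrite mulrA ler_wpM2r ?invr_ge0// heat_norm_decay// ltW.
Qed.
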